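(* Let $\mathcal{G}_T$ be a tree on the node set $\mathcal{V}$ of $N$ nodes, with a feature vector $x_i\in\mathbb{R}^{1\times C}$ attached to each node $i$ and a weight $\omega_{i,j}=\omega_{j,i}\ge 0$ on each tree edge. For a function $f:\mathbb{R}^{1\times C}\to(0,\infty)$ and a parameter $\beta\in\mathbb{R}$, consider the Markov Random Field on $\mathcal{G}_T$ with latent variables $h_i\in\mathcal{V}$ ($i\in\mathcal{V}$) whose unary terms are $$\phi_i(h_i,x_i)=\begin{cases} f(x_i) & \text{if } h_i=i,\\ \exp(-\beta) & \text{if } h_i\ne i,\end{cases}$$ and whose pairwise terms are $$\psi_{i,j}(h_i,h_j)=\begin{cases}\delta(h_i-h_j) & \text{if } h_i\notin \mathrm{Desc}_{\mathcal{G}_T}(i,j),\\ \exp(-\omega_{i,j})\,\delta(h_i-h_j) & \text{if } h_i\in \mathrm{Desc}_{\mathcal{G}_T}(i,j),\end{cases}$$ where, when computing the marginal of $h_r$, every tree edge is written as an ordered pair $(i,j)$ with $i$ the parent of $j$ in the tree rooted at $r$. Let $i,u,v\in\mathcal{V}$ be such that, when $\mathcal{G}_T$ is rooted at $i$, the node $v\ne u$ is a descendant of $u$. Then there exist $f$ and $\beta$ such that $$P_{\mathcal{G}_T}(h_i=v)>P_{\mathcal{G}_T}(h_i=u).$$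
   Context: $\delta(h_i-h_j)$ is the unit impulse: it equals $1$ if $h_i=h_j$ and $0$ otherwise. For adjacent nodes $i,j$ of the tree $\mathcal{G}_T$, $\mathrm{Desc}_{\mathcal{G}_T}(i,j)$ is the set of descendants of $j$ (including $j$ itself) when $\mathcal{G}_T$ is rooted at $i$. A Markov Random Field on $\mathcal{G}_T$ with unary terms $\phi_i$ and pairwise terms $\psi_{i,j}$ assigns to $\mathbf{H}=(h_i)_{i\in\mathcal{V}}\in\mathcal{V}^{\mathcal{V}}$ the probability $$P_{\mathcal{G}_T}(\mathbf{H})=\frac1Z\prod_{i\in\mathcal{V}}\phi_i(h_i,x_i)\prod_{(i,j)}\psi_{i,j}(h_i,h_j),$$ where the second product is over the edges of $\mathcal{G}_T$ (each edge once) and $Z$ is the partition function. Since $\psi_{i,j}$ is not symmetric in $i,j$, the orientation of the edges matters: the marginal $P_{\mathcal{G}_T}(h_r=\cdot)$ of the variable at node $r$ is computed from this joint distribution with every edge oriented away from $r$, that is, written $(i,j)$ with $i$ the parent of $j$ in the tree rooted at $r$.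
   Formalization: The formal statement adds the assumption that the feature vectors of u and v differ; if x_u = x_v, then P(h_i=v)/P(h_i=u) = exp(-sum of the weights on the path from u to v) is at most 1 for every f and β, so the claim fails. *)

(* Defs.v *)
From HB Require Import structures.
From mathcomp Require Import all_boot all_order all_algebra.
From mathcomp Require Import boolp reals sequences exp.

Set Implicit Arguments.
Unset Strict Implicit.
Unset Printing Implicit Defensive.

Import Order.TTheory GRing.Theory Num.Theory.
Local Open Scope ring_scope.

(* [ucycle e c] says that [c] is an [e]-cycle without repeated vertices; for a
   symmetric irreflexive [e] the ones of size at most 2 are the empty cycle and
   single edges traversed back and forth. *)
Record is_tree (V : finType) (e : rel V) : Prop := IsTree {
  tree_sym : symmetric e;
  tree_irr : irreflexive e;
  tree_connected : forall a b : V, connect e a b;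
  tree_acyclic : forall c : seq V, ucycle e c -> (size c <= 2)%N
}.

(* [k \in desc e r j]: [k] is a descendant of [j] (or [j] itself) in the tree
   [e] rooted at [r], i.e. [j] lies on the simple path from [r] to [k].  For
   adjacent [i] and [j], Desc(i, j) is [desc e i j]. *)
Definition desc (V : finType) (e : rel V) (r j : V) : pred V :=
  fun k => `[< exists p : seq V,
    [/\ path e r p, uniq (r :: p), last r p = k & j \in r :: p] >].

Definition parent (V : finType) (e : rel V) (r a b : V) : bool :=
  e a b && (b \in desc e r a).

Section MRF.
Variables (R : realType) (V : finType) (e : rel V) (C : nat).
Variables (x : V -> 'rV[R]_C) (omega : V -> V -> R).
Variables (f : 'rV[R]_C -> R) (beta : R).

Definition unary_term (i h : V) (y : 'rV[R]_C) : R :=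
  if h == i then f y else expR (- beta).

Definition delta (h h' : V) : R := (h == h')%:R.

Definition pairwise_term (i j h h' : V) : R :=
  if h \in desc e i j then expR (- omega i j) * delta h h' else delta h h'.

(* The pairwise terms are not symmetric, so the joint distribution depends on
   the root [r] from which the edges are oriented. *)
Definition weight (r : V) (H : {ffun V -> V}) : R :=
  (\prod_(i : V) unary_term i (H i) (x i)) *
  \prod_(p : V * V | parent e r p.1 p.2) pairwise_term p.1 p.2 (H p.1) (H p.2).

Definition partition_function (r : V) : R :=
  \sum_(H : {ffun V -> V}) weight r H.

Definition joint (r : V) (H : {ffun V -> V}) : R :=
  weight r H / partition_function r.

(* The probability that h_r = k, with every edge oriented away from [r]. *)
Definition marginal (r k : V) : R :=
  \sum_(H : {ffun V -> V} | H r == k) joint r H.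

End MRF.

(* Main.v *)
(* The impulses force a configuration of nonzero weight to be constant along
   every edge, hence constant, so P(h_r = k) is proportional to the weight of
   the constant configuration k.  For beta = 0 this weight is f (x_k) times a
   positive factor independent of f; since x_u and x_v differ, f (x_v) can be
   taken large enough to outweigh f (x_u) = 1. *)
Require Import Defs.
From mathcomp Require Import all_boot all_order all_algebra.
From mathcomp Require Import boolp reals sequences exp.

Set Implicit Arguments.
Unset Strict Implicit.
Unset Printing Implicit Defensive.

Import Order.TTheory GRing.Theory Num.Theory.
Local Open Scope ring_scope.

Lemma connected_const (V : finType) (e : rel V) (T : Type) (H : V -> T) :
  (forall a b, e a b -> H a = H b) -> forall a b, connect e a b -> H a = H b.
Proof.
move=> He a b /connectP [p pp ->] {b}.
elim: p a pp => //= c p IHp a /andP [eac pp].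
by rewrite (He _ _ eac); exact: IHp.
Qed.

(** Take a simple path from [r] to [a]. If it meets [b], then [a] is a descendant of [b]; otherwise
    appending [b] gives a simple path to [b] through [a]. *)
Lemma parent_total (V : finType) (e : rel V) (r a b : V) :
  symmetric e -> connect e r a -> e a b -> parent e r a b || parent e r b a.
Proof.
move=> sym_e /connectP [p0 pp0 a_last] eab.
case: (shortenP pp0) a_last => q pq uniq_q _ /esym lastq.
rewrite /parent (sym_e b a) eab /=.
have [b_q | b_q] := boolP (b \in r :: q); apply/orP.
  by right; apply/asboolP; exists q.
left; apply/asboolP; exists (rcons q b); split.
- by rewrite rcons_path pq lastq.
- by rewrite -rcons_cons rcons_uniq b_q.
- by rewrite last_rcons.
- by rewrite -rcons_cons mem_rcons inE -lastq mem_last orbT.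
Qed.

Section Marginals.
Variables (R : realType) (V : finType) (e : rel V) (C : nat).
Variables (x : V -> 'rV[R]_C) (omega : V -> V -> R).
Hypotheses (sym_e : symmetric e) (connected_e : forall a b, connect e a b).

(** The part of the weight of the constant configuration [k] that is independent of [f]. All
    impulses equal 1 there, so only the exponential factors remain. *)
Definition edge_weight (r k : V) : R :=
  \prod_(p : V * V | parent e r p.1 p.2) pairwise_term e omega p.1 p.2 k k.

Lemma edge_weight_gt0 (r k : V) : 0 < edge_weight r k.
Proof.
apply: prodr_gt0 => p _; rewrite /pairwise_term /delta eqxx mulr1.
by case: ifP => // _; exact: expR_gt0.
Qed.

Variable f : 'rV[R]_C -> R.

Lemma weight_const (r k : V) :
  weight e x omega f 0 r [ffun=> k] = f (x k) * edge_weight r k.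
Proof.
rewrite /weight; congr (_ * _); last first.
  by apply: eq_bigr => p _; rewrite !ffunE.
rewrite (bigD1 k) //= big1 ?mulr1 /unary_term ?ffunE ?eqxx // => j j_neq_k.
by rewrite ffunE eq_sym (negPf j_neq_k) oppr0 expR0.
Qed.

(** Some orientation of the edge indexes a factor of the weight, and both branches of that factor
    carry the impulse, which vanishes when the end values differ. *)
Lemma weight_edge_neq0 (beta : R) (r : V) (H : {ffun V -> V}) (a b : V) :
  weight e x omega f beta r H != 0 -> e a b -> H a = H b.
Proof.
move=> wH eab; apply: contraNeq wH => Hab.
(* The claim is symmetric in [a] and [b], so the edge may be taken as oriented from [a] to [b]. *)
wlog par_ab : a b eab Hab / parent e r a b.
  move=> IH; case/orP: (parent_total sym_e (connected_e r a) eab) => par.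
    exact: (IH a b).
  by apply: (IH b a) => //; rewrite 1?sym_e // eq_sym.
rewrite /weight (bigD1 (a, b)) //= /pairwise_term /delta (negPf Hab).
by rewrite mulr0 if_same mul0r mulr0.
Qed.

Lemma weight_neq0 (beta : R) (r : V) (H : {ffun V -> V}) :
  weight e x omega f beta r H != 0 -> H = [ffun=> H r].
Proof.
move=> wH; apply/ffunP => a; rewrite ffunE.
apply: (@connected_const _ e _ H) (connected_e a r) => b c.
exact: weight_edge_neq0 wH.
Qed.

Lemma marginalE (beta : R) (r k : V) :
  marginal e x omega f beta r k =
  weight e x omega f beta r [ffun=> k] / partition_function e x omega f beta r.
Proof.
rewrite /marginal (bigD1 [ffun=> k]) /= ?ffunE ?eqxx // big1 ?addr0 //.
move=> H /andP [/eqP Hr]; rewrite -Hr /joint => H_neq.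
have [-> | /weight_neq0 H_const] := eqVneq (weight e x omega f beta r H) 0.
  by rewrite mul0r.
by rewrite -H_const eqxx in H_neq.
Qed.

Hypothesis f_gt0 : forall y, 0 < f y.

(** Constant configurations have positive weight and all others have weight 0. Positivity lets the
    normalisation cancel when two marginals are compared. *)
Lemma partition_function_gt0 (r : V) :
  0 < partition_function e x omega f 0 r.
Proof.
have const_gt0 k : 0 < weight e x omega f 0 r [ffun=> k].
  by rewrite weight_const mulr_gt0 ?edge_weight_gt0.
rewrite /partition_function (bigD1 [ffun=> r]) //= ltr_pwDl //.
apply: sumr_ge0 => H _.
have [-> // | /weight_neq0 ->] := eqVneq (weight e x omega f 0 r H) 0.
exact: ltW.
Qed.

Lemma ltr_marginal (r k l : V) :
  (marginal e x omega f 0 r k < marginal e x omega f 0 r l) =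
  (f (x k) * edge_weight r k < f (x l) * edge_weight r l).
Proof.
by rewrite !marginalE !weight_const ltr_pM2r ?invr_gt0 ?partition_function_gt0.
Qed.

End Marginals.

Theorem lemma3 (R : realType) (V : finType) (e : rel V) (C : nat)
    (x : V -> 'rV[R]_C) (omega : V -> V -> R) (i u v : V)
    (tree_e : is_tree e)
    (omega_sym : forall a b : V, e a b -> omega a b = omega b a)
    (omega_ge0 : forall a b : V, e a b -> 0 <= omega a b)
    (v_neq_u : v <> u)
    (v_desc_u : v \in desc e i u)
    (x_neq : x u <> x v) :
  exists (f : 'rV[R]_C -> R) (beta : R),
    (forall y : 'rV[R]_C, 0 < f y) /\
    marginal e x omega f beta i u < marginal e x omega f beta i v.
Proof.
have [sym_e _ connected_e _] := tree_e.
have wu_gt0 := edge_weight_gt0 e omega i u.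
have wv_gt0 := edge_weight_gt0 e omega i v.
set wu := edge_weight e omega i u in wu_gt0.
set wv := edge_weight e omega i v in wv_gt0.
(* The value at [x v] is chosen so that [f (x v) * wv = wv + wu], which exceeds [f (x u) * wu = wu]
   because [wv] is positive. *)
pose f y := if y == x v then 1 + wu / wv else 1.
have f_gt0 y : 0 < f y.
  by rewrite /f; case: ifP => // _; rewrite addr_gt0 ?divr_gt0.
exists f, 0; split=> //; rewrite ltr_marginal // -/wu -/wv /f eqxx.
by rewrite (negPf (introN eqP x_neq)) mulrDl divfK ?gt_eqF // !mul1r ltrDr.
Qed.
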